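(* There is a constant $C$ such that for every $n\ge 1$ the following holds. Let $\Delta$ be an upward equilateral triangle of side length $n$ in the unit triangular grid, placed (at any grid position) over a grid of unit hexagons. Let $\mathcal{F}_1$ be the fine mixed subdivision of $\Delta$ obtained by tiling each hexagon in the clockwise manner, and $\mathcal{F}_2$ the one obtained by tiling each hexagon in the counterclockwise manner (in both cases trimming off half of each rhombus that crosses the boundary of $\Delta$). Then at least $\frac{2n^2}{3}-n-C$ trapezoid flips are needed to change from $\mathcal{F}_1$ to $\mathcal{F}_2$.
   Context: All triangles are equilateral and grid-aligned; ''upward'' means having the same orientation as $\Delta$, which has a horizontal bottom side. A rhombus is the union of two unit grid triangles sharing an edge. A fine mixed subdivision of $\Delta$ is a partition of $\Delta$ into $n$ upward unit triangles (holes) and $\binom{n}{2}$ rhombi. A grid of unit hexagons is a tiling of the plane by regular hexagons of side $1$, each being the union of six unit triangles of the triangular grid around a grid vertex. Each hexagon has exactly two rhombus tilings (into three rhombi): the clockwise one is that in which the vertical rhombus (the one without horizontal edges) lies on the left side of the hexagon, i.e. contains the leftmost vertex of the hexagon; the counterclockwise one is the other. Tiling all hexagons in the same manner gives a rhombus tiling of the plane; each rhombus with one unit triangle inside $\Delta$ and one outside is replaced by its half inside $\Delta$ (an upward unit triangle, becoming a hole), and rhombi outside $\Delta$ are discarded, giving a fine mixed subdivision of $\Delta$. A trapezoid flip replaces a unit triangular hole and an adjacent rhombus that together form a trapezoid (of side lengths $1,1,1,2$) with the other decomposition of the same trapezoid into an upward unit triangle and a rhombus, leaving everything else unchanged. 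*)

(* Defs.v *)
From mathcomp Require Export all_boot all_order all_algebra.
From mathcomp Require Export finmap.

Set Implicit Arguments.
Unset Strict Implicit.
Unset Printing Implicit Defensive.

Import GRing.Theory Num.Theory.
Local Open Scope fset_scope.
Local Open Scope ring_scope.

(* The grid vertex a e1 + b e2, with e1 = (1, 0) and e2 = (1/2, sqrt 3 / 2),
   is encoded as (a, b); b is thus its height. *)
Definition point : Type := (int * int)%type.

(* (true, x) is the upward unit triangle whose lower left vertex is x;
   (false, x) is the downward one forming with it the unit parallelogram
   x, x + e1, x + e1 + e2, x + e2. *)
Definition triangle : Type := (bool * point)%type.

Definition vertices (t : triangle) : {fset point} :=
  let: (upward, (a, b)) := t in
  if upward then [fset ((a, b) : point); (a + 1, b); (a, b + 1)]
  else [fset ((a + 1, b) : point); (a, b + 1); (a + 1, b + 1)].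

(* A polygonal region is given by its unit triangles. *)
Definition tile : Type := {fset triangle}.

Definition share_edge (t u : triangle) : bool :=
  #|` vertices t `&` vertices u| == 2%N.

Definition is_hole (s : tile) : Prop := exists x : point, s = [fset (true, x)].

Definition is_rhombus (s : tile) : Prop :=
  exists t u : triangle, share_edge t u /\ s = [fset t; u].

(* Three unit triangles in a row: the side lengths are then 1, 1, 1, 2. *)
Definition is_trapezoid (s : tile) : Prop :=
  exists t u v : triangle,
    [/\ share_edge t u, share_edge t v, u != v & s = [fset t; u; v]].

Definition partitions (F : {fset tile}) (D : pred triangle) : Prop :=
  [/\ fset0 \notin F,
      forall t, D t <-> exists2 s, s \in F & t \in s
    & forall s s' t, s \in F -> s' \in F -> t \in s -> t \in s' -> s = s'].

(* The upward triangle of side length n with lower left vertex p. *)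
Definition in_Delta (p : point) (n : nat) (t : triangle) : bool :=
  all (fun x : point =>
         [&& p.1 <= x.1, p.2 <= x.2 & x.1 + x.2 <= p.1 + p.2 + n%:Z])
      (vertices t).

Definition fine_mixed_subdivision (p : point) (n : nat) (F : {fset tile}) :
    Prop :=
  partitions F (in_Delta p n) /\
  exists H R : {fset tile},
    [/\ F = H `|` R,
        forall s, s \in H -> is_hole s, #|` H| = n,
        forall s, s \in R -> is_rhombus s & #|` R| = 'C(n, 2)].

(* The hexagon of side 1 centred at v. *)
Definition in_hexagon (v : point) (t : triangle) : bool := v \in vertices t.

(* A tiling of the plane by unit hexagons, given by their centres. *)
Definition hexagon_grid (c : pred point) : Prop :=
  forall t : triangle, exists! v : point, c v /\ in_hexagon v t.

(* The segment xy joining two vertices is a boundary edge of s. *)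
Definition boundary_edge (s : tile) (x y : point) : bool :=
  (x != y) &&
  (#|` [fset t in s | (x \in vertices t) && (y \in vertices t)]| == 1%N).

Definition vertical (s : tile) : Prop :=
  forall x y : point, boundary_edge s x y -> x.2 != y.2.

Definition leftmost (v : point) : point := (v.1 - 1, v.2).

Definition hexagon_tiling (v : point) (P : {fset tile}) : Prop :=
  partitions P (in_hexagon v) /\ forall s, s \in P -> is_rhombus s.

Definition clockwise (v : point) (P : {fset tile}) : Prop :=
  hexagon_tiling v P /\
  exists s, [/\ s \in P, vertical s
              & exists2 t, t \in s & leftmost v \in vertices t].

Definition counterclockwise (v : point) (P : {fset tile}) : Prop :=
  hexagon_tiling v P /\ ~ clockwise v P.

Definition plane_rhombus (manner : point -> {fset tile} -> Prop)
    (c : pred point) (r : tile) : Prop :=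
  exists v P, [/\ c v, manner v P & r \in P].

(* Intersecting with Delta keeps the rhombi inside Delta and halves those that
   cross its boundary; s != fset0 discards the rhombi outside Delta. *)
Definition trimmed_tiling (manner : point -> {fset tile} -> Prop)
    (c : pred point) (p : point) (n : nat) (F : {fset tile}) : Prop :=
  forall s : tile, s \in F <->
    s != fset0 /\
    exists2 r, plane_rhombus manner c r & s = [fset t in r | in_Delta p n t].

Definition trapezoid_flip (F F' : {fset tile}) : Prop :=
  exists h r h' r' : tile,
    [/\ [/\ is_hole h, is_rhombus r, is_hole h' & is_rhombus r'],
        [/\ h \in F, r \in F & h' != h],
        is_trapezoid (h `|` r), h' `|` r' = h `|` r
      & F' = (F `\` [fset h; r]) `|` [fset h'; r']].

Definition flips (p : point) (n k : nat) (F F' : {fset tile}) : Prop :=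
  exists G : nat -> {fset tile},
    [/\ G 0%N = F, G k = F',
        forall i, (i <= k)%N -> fine_mixed_subdivision p n (G i)
      & forall i, (i < k)%N -> trapezoid_flip (G i) (G i.+1)].

(* Main.v *)
Require Import Defs.
From mathcomp Require Import zify lra.

Set Implicit Arguments.
Unset Strict Implicit.
Unset Printing Implicit Defensive.

Import GRing.Theory Num.Theory.
Local Open Scope fset_scope.
Local Open Scope ring_scope.

(* Every downward triangle of Delta lies in a rhombus whose other half is an
   adjacent upward triangle, and a trapezoid flip changes the rhombus of exactly
   one downward triangle. All n(n-1)/2 of them have different rhombi in the
   clockwise and the counterclockwise tiling, so each has to be flipped. Inside
   a full hexagon flipping each of the three once is impossible: the first
   flip would need an upward triangle that is still occupied. So every hexagon
   inside Delta costs one more flip, and there are about (n-1)(n-2)/6 of them: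
   any three consecutive grid vertices on a line contain one hexagon centre. *)

(** * Vertices and edges of unit triangles, and membership in Delta *)

Lemma vertices_upP (a b : int) (x : point) :
  reflect ([\/ x = (a, b), x = (a + 1, b) | x = (a, b + 1)])
          (x \in vertices (true, (a, b))).
Proof.
rewrite !inE -orbA.
by apply: (iffP or3P) => -[E|E|E];
  [constructor 1 | constructor 2 | constructor 3 | constructor 1
  | constructor 2 | constructor 3]; exact/eqP.
Qed.

Lemma vertices_downP (a b : int) (x : point) :
  reflect ([\/ x = (a + 1, b), x = (a, b + 1) | x = (a + 1, b + 1)])
          (x \in vertices (false, (a, b))).
Proof.
rewrite !inE -orbA.
by apply: (iffP or3P) => -[E|E|E];
  [constructor 1 | constructor 2 | constructor 3 | constructor 1
  | constructor 2 | constructor 3]; exact/eqP.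
Qed.

Lemma share_edgeP (t u : triangle) : share_edge t u ->
  exists x y, [/\ x != y, x \in vertices t, x \in vertices u,
                  y \in vertices t & y \in vertices u].
Proof.
move=> /eqP card2.
have /fset0Pn[x xI]: vertices t `&` vertices u != fset0.
  by rewrite -cardfs_gt0 card2.
have /fset0Pn[y]: (vertices t `&` vertices u) `\ x != fset0.
  by rewrite -cardfs_gt0; move: card2; rewrite (cardfsD1 x) xI; lia.
rewrite in_fsetD1 => /andP[neq_yx]; move: xI; rewrite !in_fsetI.
by move=> /andP[? ?] /andP[? ?]; exists x, y; rewrite eq_sym.
Qed.

Lemma share_edgeC (t u : triangle) : share_edge t u = share_edge u t.
Proof. by rewrite /share_edge fsetIC. Qed.

Lemma share_edge_down (a b : int) (u : triangle) :
  share_edge (false, (a, b)) u ->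
  [\/ u = (true, (a, b)), u = (true, (a + 1, b)) | u = (true, (a, b + 1))].
Proof.
move=> e; move: (e) => /share_edgeP[[x1 x2] [[y1 y2] [/eqP neq_xy]]].
case: u e => [[|] [a' b']] e.
  move=> /vertices_downP Hx /vertices_upP Hx' /vertices_downP Hy /vertices_upP Hy'.
  have: (a' = a /\ b' = b) \/ (a' = a + 1 /\ b' = b) \/ (a' = a /\ b' = b + 1).
    case: Hx => [] [? ?]; case: Hx' => [] [? ?];
    case: Hy => [] [? ?]; case: Hy' => [] [? ?]; subst; try lia;
    case: neq_xy; congr (_, _); lia.
  by case=> [[-> ->]|[[-> ->]|[-> ->]]]; constructor.
move=> /vertices_downP Hx /vertices_downP Hx' /vertices_downP Hy /vertices_downP Hy'.
have [eq_a eq_b]: a' = a /\ b' = b.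
  case: Hx => [] [? ?]; case: Hx' => [] [? ?];
  case: Hy => [] [? ?]; case: Hy' => [] [? ?]; subst; try lia;
  case: neq_xy; congr (_, _); lia.
(* A triangle shares three vertices with itself, not two. *)
move: e; rewrite eq_a eq_b /share_edge fsetIid /vertices -fsetUA !cardfsU1 cardfs1 !inE.
by rewrite !xpair_eqE; lia.
Qed.

Lemma in_Delta_up (p : point) (n : nat) (a b : int) :
  in_Delta p n (true, (a, b)) =
    [&& p.1 <= a, p.2 <= b & a + b + 1 <= p.1 + p.2 + n%:Z].
Proof.
apply/allP/and3P => [in_tri|[? ? ?] x /vertices_upP[] -> /=]; last 3 first.
- by apply/and3P; split; lia.
- by apply/and3P; split; lia.
- by apply/and3P; split; lia.
have /and3P[/= ? ? _]: [&& p.1 <= (a, b).1, p.2 <= (a, b).2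
    & (a, b).1 + (a, b).2 <= p.1 + p.2 + n%:Z].
  by apply: in_tri; apply/vertices_upP; constructor.
have /and3P[/= _ _ ?]: [&& p.1 <= (a + 1, b).1, p.2 <= (a + 1, b).2
    & (a + 1, b).1 + (a + 1, b).2 <= p.1 + p.2 + n%:Z].
  by apply: in_tri; apply/vertices_upP; constructor.
by split=> //; lia.
Qed.

Lemma in_Delta_down (p : point) (n : nat) (a b : int) :
  in_Delta p n (false, (a, b)) =
    [&& p.1 <= a, p.2 <= b & a + b + 2 <= p.1 + p.2 + n%:Z].
Proof.
apply/allP/and3P => [in_tri|[? ? ?] x /vertices_downP[] -> /=]; last 3 first.
- by apply/and3P; split; lia.
- by apply/and3P; split; lia.
- by apply/and3P; split; lia.
have /and3P[/= _ ? _]: [&& p.1 <= (a + 1, b).1, p.2 <= (a + 1, b).2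
    & (a + 1, b).1 + (a + 1, b).2 <= p.1 + p.2 + n%:Z].
  by apply: in_tri; apply/vertices_downP; constructor.
have /and3P[/= ? _ _]: [&& p.1 <= (a, b + 1).1, p.2 <= (a, b + 1).2
    & (a, b + 1).1 + (a, b + 1).2 <= p.1 + p.2 + n%:Z].
  by apply: in_tri; apply/vertices_downP; constructor.
have /and3P[/= _ _ ?]: [&& p.1 <= (a + 1, b + 1).1, p.2 <= (a + 1, b + 1).2
    & (a + 1, b + 1).1 + (a + 1, b + 1).2 <= p.1 + p.2 + n%:Z].
  by apply: in_tri; apply/vertices_downP; constructor.
by split=> //; lia.
Qed.

(** * The six triangles of a hexagon, partitions and rhombi *)

(* The triangles around [v] alternate, counterclockwise from the direction of
   e1: sector_up v 0, sector_down v 0, sector_up v 1, ..., sector_down v 2. *)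
Definition sector_up (v : point) (o : 'I_3) : triangle :=
  (true, [:: (v.1, v.2); (v.1 - 1, v.2); (v.1, v.2 - 1)]`_o).

Definition sector_down (v : point) (o : 'I_3) : triangle :=
  (false, [:: (v.1 - 1, v.2); (v.1 - 1, v.2 - 1); (v.1, v.2 - 1)]`_o).

(** [sector_down v o] is paired with its clockwise neighbour here, and with its counterclockwise
    neighbour in [ccw_rhombus]; indices are taken modulo 3. *)
Definition cw_rhombus (v : point) (o : 'I_3) : tile :=
  [fset sector_down v o; sector_up v o].

Definition ccw_rhombus (v : point) (o : 'I_3) : tile :=
  [fset sector_down v o; sector_up v (o + 1)].

Lemma share_edge_orient (t u : triangle) : share_edge t u -> t.1 != u.1.
Proof.
case: t u => [[|] [a b]] [[|] x] // e.
- have [y [z [/eqP neq_yz]]] := share_edgeP e.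
  case: x e => [a' b'] e.
  move=> /vertices_upP Hy /vertices_upP Hy' /vertices_upP Hz /vertices_upP Hz'.
  have [eq_a eq_b]: a' = a /\ b' = b.
    move: y z Hy Hy' Hz Hz' neq_yz => [? ?] [? ?] Hy Hy' Hz Hz' neq_yz.
    case: Hy => [] [? ?]; case: Hy' => [] [? ?];
    case: Hz => [] [? ?]; case: Hz' => [] [? ?]; subst; try lia;
    case: neq_yz; congr (_, _); lia.
  move: e; rewrite eq_a eq_b /share_edge fsetIid /vertices -fsetUA !cardfsU1.
  by rewrite cardfs1 !inE !xpair_eqE; lia.
- by case: (share_edge_down e).
Qed.

Lemma partitions_tile (F : {fset tile}) (D : pred triangle) (t : triangle) :
  partitions F D -> D t -> exists2 s, s \in F & t \in s.
Proof. by case=> _ cover _ /cover. Qed.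

Lemma partitions_sub (F : {fset tile}) (D : pred triangle) (s : tile)
    (t : triangle) :
  partitions F D -> s \in F -> t \in s -> D t.
Proof. by case=> _ cover _ sF ts; apply/cover; exists s. Qed.

Lemma partitions_inj (F : {fset tile}) (D : pred triangle) (s s' : tile)
    (t : triangle) :
  partitions F D -> s \in F -> s' \in F -> t \in s -> t \in s' -> s = s'.
Proof. by case=> _ _; apply. Qed.

Lemma rhombus_down (s : tile) (x : point) :
  is_rhombus s -> (false, x) \in s ->
  exists2 u, share_edge (false, x) u & s = [fset (false, x); u].
Proof.
case=> t [u [e ->]] /fset2P[eq_x|eq_x]; first by exists u; rewrite eq_x.
by exists t; rewrite eq_x 1?share_edgeC 1?fsetUC.
Qed.

(** The halves of a rhombus have opposite orientations. This is why replacing one rhombus affects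
    only one downward triangle. *)
Lemma rhombus_down_inj (s : tile) (x y : point) :
  is_rhombus s -> (false, x) \in s -> (false, y) \in s -> x = y.
Proof.
move=> rs xs; have [u e ->] := rhombus_down rs xs.
by case/fset2P=> [[]|eq_y] //; have := share_edge_orient e; rewrite -eq_y.
Qed.

Lemma ord3P (o : 'I_3) : [\/ o = 0, o = 1 | o = 1 + 1].
Proof.
by case: o => [[|[|[|//]]] lto]; [constructor 1 | constructor 2 | constructor 3];
  apply: val_inj.
Qed.

(** * The two rhombus tilings of a hexagon *)

Lemma in_hexagon_down (v : point) (x : point) :
  in_hexagon v (false, x) -> exists o, (false, x) = sector_down v o.
Proof.
case: x => a b /vertices_downP[] ->.
- by exists 0; congr (_, (_, _)) => /=; lia.
- by exists (1 + 1); congr (_, (_, _)) => /=; lia.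
- by exists 1; congr (_, (_, _)) => /=; lia.
Qed.

Lemma sector_down_in_hexagon (v : point) (o : 'I_3) :
  in_hexagon v (sector_down v o).
Proof.
case: v => a b; case: (ord3P o) => ->; apply/vertices_downP => /=.
- by constructor 1; congr (_, _); lia.
- by constructor 3; congr (_, _); lia.
- by constructor 2; congr (_, _); lia.
Qed.

Lemma sector_down_rhombus (v : point) (s : tile) (o : 'I_3) :
  is_rhombus s -> (forall t, t \in s -> in_hexagon v t) ->
  sector_down v o \in s -> s = cw_rhombus v o \/ s = ccw_rhombus v o.
Proof.
move=> rs s_hex ds; have [u e def_s] := rhombus_down rs ds.
have : in_hexagon v u by apply: s_hex; rewrite def_s fset22.
rewrite {s rs s_hex ds}def_s /cw_rhombus /ccw_rhombus.
case: v e => a b.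
case: (ord3P o) => -> /share_edge_down[] -> v_u;
  [right | left | | | right | left | left | | right];
  try (by congr [fset _; (_, (_, _))] => /=; lia);
  by exfalso; move: v_u; rewrite /in_hexagon !inE !xpair_eqE /=; lia.
Qed.

(** A rhombus [ccw_rhombus v o] occupies [sector_up v (o + 1)], which forces the next sector to be
    counterclockwise too; going round, one such rhombus forces all three. *)
Lemma hexagon_tiling_cases (v : point) (P : {fset tile}) :
  hexagon_tiling v P ->
  (forall o, cw_rhombus v o \in P) \/ (forall o, ccw_rhombus v o \in P).
Proof.
case=> partP rhP.
have tile_of o : cw_rhombus v o \in P \/ ccw_rhombus v o \in P.
  have [s sP ds] := partitions_tile partP (sector_down_in_hexagon v o).
  have s_hex t : t \in s -> in_hexagon v t by apply: partitions_sub partP sP.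
  by have [<-|<-] := sector_down_rhombus (rhP s sP) s_hex ds; [left | right].
have excl o : ccw_rhombus v o \in P -> cw_rhombus v (o + 1) \notin P.
  move=> ccwP; apply/negP => cwP.
  have /fsetP/(_ (sector_down v o)) :=
    partitions_inj partP ccwP cwP (fset22 _ _) (fset22 _ _).
  rewrite fset21 !inE; case: v {ccwP cwP tile_of partP} => a b.
  by case: (ord3P o) => ->; rewrite !xpair_eqE /=; lia.
have next o : ccw_rhombus v o \in P -> ccw_rhombus v (o + 1) \in P.
  by move=> /excl ncw; case: (tile_of (o + 1)) ncw => // ->.
case: (boolP [exists o, ccw_rhombus v o \in P]) => [/existsP[o ccwP]|]; last first.
  rewrite negb_exists => /forallP ncw; left=> o.
  by case: (tile_of o) (ncw o) => // ->.
right=> o'; have ccw1 := next _ ccwP; have ccw2 := next _ ccw1.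
have [-> // | -> // | -> //]: [\/ o' = o, o' = o + 1 | o' = o + 1 + 1].
by case: (ord3P o) => ->; case: (ord3P o') => ->;
  first [constructor 1; exact: val_inj | constructor 2; exact: val_inj
        | constructor 3; exact: val_inj].
Qed.

Lemma vertical_cw_rhombus (v : point) : vertical (cw_rhombus v 1).
Proof.
case: v => a b [x1 x2] [y1 y2] /andP[neq_xy /cardfs1P[t0 def_t0]] /=.
apply/eqP => eq_xy; subst y2.
(* The only horizontal edge of either half is their common one, which is interior to the rhombus. *)
have both: ((x1, x2) \in vertices (sector_down (a, b) 1)) &&
           ((y1, x2) \in vertices (sector_down (a, b) 1)) =
           ((x1, x2) \in vertices (sector_up (a, b) 1)) &&
           ((y1, x2) \in vertices (sector_up (a, b) 1)).
  move: neq_xy; rewrite !inE !xpair_eqE /=; lia.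
have : t0 \in [fset t0] by rewrite fset11.
have in_filter (t : triangle) :
    (t \in [fset t0]) = (t \in cw_rhombus (a, b) 1) &&
    (((x1, x2) \in vertices t) && ((y1, x2) \in vertices t)).
  by rewrite -def_t0 !inE.
rewrite in_filter => /andP[/fset2P[eq_t0|eq_t0] xy_t0].
  have : sector_up (a, b) 1 \in [fset t0].
    by rewrite in_filter fset22 -both -eq_t0.
  by move=> /fset1P; rewrite eq_t0.
have : sector_down (a, b) 1 \in [fset t0].
  by rewrite in_filter fset21 both -eq_t0.
by move=> /fset1P; rewrite eq_t0.
Qed.

(** The horizontal segment from the leftmost vertex to the centre separates two counterclockwise
    rhombi, so it is a boundary edge of each of them. *)
Lemma leftmost_ccw_not_vertical (v : point) (o : 'I_3) (t : triangle) :
  t \in ccw_rhombus v o -> leftmost v \in vertices t ->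
  ~ vertical (ccw_rhombus v o).
Proof.
move=> ts lt vert; suff: boundary_edge (ccw_rhombus v o) (leftmost v) v.
  by move=> /vert; rewrite eqxx.
apply/andP; split; first by case: v {ts lt vert} => a b; rewrite xpair_eqE /=; lia.
apply/cardfs1P; exists t; apply/fsetP => u; rewrite !inE.
apply/andP/eqP => [[u_s /andP[lu vu]]|->{u}].
  move: ts lt u_s lu vu {vert}; case: v => a b /fset2P[] -> lt /orP[] /eqP -> //;
  move=> lu vu; exfalso; move: lt lu vu; case: (ord3P o) => ->; rewrite !inE !xpair_eqE /=; lia.
move: ts lt {vert}; case: v => a b /fset2P[] ->; case: (ord3P o) => ->;
  rewrite !inE !xpair_eqE /=; lia.
Qed.

Lemma clockwise_cw_rhombus (v : point) (P : {fset tile}) (o : 'I_3) :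
  clockwise v P -> cw_rhombus v o \in P.
Proof.
case=> tilP [s [sP vert [t ts lt]]].
case: (hexagon_tiling_cases tilP) => // ccwP; exfalso.
case: tilP => partP rhP.
(* Only [sector_up v 1] and [sector_down v 1] touch the leftmost vertex; they lie in the
   counterclockwise rhombi 0 and 1. *)
have [o' ts']: exists o', t \in ccw_rhombus v o'.
  have vt := partitions_sub partP sP ts; move: lt vt {vert ts}.
  case: t => [[|] [a' b']]; case: v {ccwP partP sP} => a b lt vt.
    by exists 0; move: lt vt; rewrite /in_hexagon !inE !xpair_eqE /=; lia.
  by exists 1; move: lt vt; rewrite /in_hexagon !inE !xpair_eqE /=; lia.
apply: (leftmost_ccw_not_vertical ts' lt).
by rewrite -(partitions_inj partP sP (ccwP o') ts ts').
Qed.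

(** Being counterclockwise is defined by negation, so the other tiling is excluded by exhibiting its
    vertical rhombus, [cw_rhombus v 1]. *)
Lemma counterclockwise_ccw_rhombus (v : point) (P : {fset tile}) (o : 'I_3) :
  counterclockwise v P -> ccw_rhombus v o \in P.
Proof.
case=> tilP ncw; case: (hexagon_tiling_cases tilP) => // cwP; case: ncw.
split=> //; exists (cw_rhombus v 1); split; [by [] | exact: vertical_cw_rhombus |].
exists (sector_down v 1); first exact: fset21.
case: v {tilP cwP} => a b.
by rewrite !inE !xpair_eqE /=; lia.
Qed.

Lemma sector_down_next (v : point) (o : 'I_3) :
  sector_down v o != sector_down v (o + 1).
Proof. by case: v => a b; case: (ord3P o) => ->; rewrite !xpair_eqE /=; lia. Qed.

Lemma sector_up_next (v : point) (o : 'I_3) :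
  sector_up v o != sector_up v (o + 1).
Proof. by case: v => a b; case: (ord3P o) => ->; rewrite !xpair_eqE /=; lia. Qed.

Lemma cw_neq_ccw_rhombus (v : point) (o : 'I_3) :
  cw_rhombus v o != ccw_rhombus v o.
Proof.
apply/eqP => /fsetP/(_ (sector_up v o)); rewrite fset22 => /esym/fset2P[] //.
exact/eqP/sector_up_next.
Qed.

(** * The tile of a downward triangle, under flips and in trimmed tilings *)

(** A set of tiles makes this total and comparable by [==]; in a partition it is a singleton at
    every covered triangle. *)
Definition tiles_at (F : {fset tile}) (t : triangle) : {fset tile} :=
  [fset s in F | t \in s].

(** Holes are upward, so [r] and [r'] contain the same downward triangles of the trapezoid, and a
    rhombus has room for only one. *)
Lemma trapezoid_flip_down (F F' : {fset tile}) (x y : point) :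
  trapezoid_flip F F' -> x != y ->
  tiles_at F (false, x) = tiles_at F' (false, x) \/
  tiles_at F (false, y) = tiles_at F' (false, y).
Proof.
case=> h [r [h' [r' [[hole_h rh_r hole_h' rh_r'] _ _ eq_hr ->]]]] neq_xy.
have nhole (s : tile) z : is_hole s -> (false, z) \in s = false.
  by case=> z' ->; rewrite inE.
have in_r z : (false, z) \in r' = ((false, z) \in r).
  move/fsetP/(_ (false, z)): eq_hr; rewrite !in_fsetU.
  by rewrite (nhole h z) ?(nhole h' z).
(* A tile containing such a triangle is none of [h], [r], [h'], [r']. *)
have same z : (false, z) \notin r ->
    tiles_at F (false, z) =
    tiles_at (F `\` [fset h; r] `|` [fset h'; r']) (false, z).
  move=> nz; apply/fsetP => s; rewrite !inE.
  case: (boolP ((false, z) \in s)) => zs; rewrite ?andbF ?andbT //.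
  have ne (s0 : tile) : (false, z) \in s0 = false -> (s == s0) = false.
    by move=> nz0; apply/eqP => eq_s; rewrite -eq_s zs in nz0.
  have nr : (false, z) \in r' = false by rewrite in_r (negbTE nz).
  rewrite (ne h) ?nhole // (ne h') ?nhole // (ne r) ?(negbTE nz) // (ne r') //.
 by rewrite !orbF.
case: (boolP ((false, x) \in r)) => [xr|]; last by left; apply: same.
case: (boolP ((false, y) \in r)) => [yr|]; last by right; apply: same.
by rewrite (rhombus_down_inj rh_r xr yr) eqxx in neq_xy.
Qed.

Lemma tiles_at_partition (F : {fset tile}) (D : pred triangle) (s : tile)
    (t : triangle) :
  partitions F D -> s \in F -> t \in s -> tiles_at F t = [fset s].
Proof.
move=> partF sF ts; apply/fsetP => s'; rewrite !inE.
apply/andP/eqP => [[s'F ts']|-> //].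
exact: partitions_inj partF s'F sF ts' ts.
Qed.

(** Abstracting over [manner] and [R] serves both tilings. The triangle lies in only one hexagon of
    the grid, and trimming leaves a rhombus inside Delta intact. *)
Lemma trimmed_tiles_at (manner : point -> {fset tile} -> Prop)
    (R : point -> 'I_3 -> tile) (c : pred point) (p : point) (n : nat)
    (F : {fset tile}) (v : point) (o : 'I_3) :
  (forall w P, manner w P -> hexagon_tiling w P) ->
  (forall w P, manner w P -> R w o \in P) ->
  hexagon_grid c -> trimmed_tiling manner c p n F ->
  partitions F (in_Delta p n) -> c v -> sector_down v o \in R v o ->
  (forall t, t \in R v o -> in_Delta p n t) ->
  tiles_at F (sector_down v o) = [fset R v o].
Proof.
move=> tilM RM grid trimF partF cv dR R_Delta.
have [s sF ds] := partitions_tile partF (R_Delta _ dR).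
rewrite (tiles_at_partition partF sF ds); congr [fset _].
have [_ [r [w [P [cw mP rP]]] def_s]] := (trimF s).1 sF.
have [partP rhP] := tilM _ _ mP.
have dr : sector_down v o \in r by move: ds; rewrite def_s !inE => /andP[].
have eq_w : w = v.
  have [w' [_ uniq_w]] := grid (sector_down v o).
  have <- : w' = w by apply: uniq_w; split=> //; apply: partitions_sub partP rP dr.
  by apply: uniq_w; split=> //; apply: sector_down_in_hexagon.
have eq_r : r = R v o.
  by rewrite eq_w in mP; apply: partitions_inj partP rP (RM _ _ mP) dr dR.
rewrite def_s eq_r; apply/fsetP => t; rewrite !inE.
by case: (boolP (t \in R v o)) => [/R_Delta ->|].
Qed.

(** All edge-neighbours of a downward triangle of Delta lie in Delta: a rhombus crossing the
    boundary always has its upward half inside. *)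
Lemma rhombus_in_Delta (p : point) (n : nat) (v : point) (o : 'I_3) :
  in_Delta p n (sector_down v o) ->
  {in cw_rhombus v o, forall t, in_Delta p n t} /\
  {in ccw_rhombus v o, forall t, in_Delta p n t}.
Proof.
move=> dD; suff [upD upD']: in_Delta p n (sector_up v o) /\
    in_Delta p n (sector_up v (o + 1)).
  by split=> t /fset2P[] ->.
case: p v dD => p1 p2 [a b].
by case: (ord3P o) => ->; rewrite in_Delta_down !in_Delta_up /=; lia.
Qed.

(** * Counting changes, and the extra flip in a full hexagon *)

Definition changes (T : eqType) (f : nat -> T) (k : nat) : nat :=
  \sum_(i < k) (f i != f i.+1).

Lemma changes_eq0 (T : eqType) (f : nat -> T) (k : nat) :
  changes f k = 0%N -> forall i, (i <= k)%N -> f i = f 0%N.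
Proof.
rewrite /changes; elim: k => [_ [|i] //|k IHk]; rewrite big_ord_recr /=.
move/eqP; rewrite addn_eq0 eqb0 negbK => /andP[/eqP/IHk eq_f /eqP eq_fk] i.
by rewrite leq_eqVlt => /predU1P[->|/eq_f //]; rewrite -eq_fk eq_f.
Qed.

Lemma changes_eq1 (T : eqType) (f : nat -> T) (k : nat) :
  changes f k = 1%N ->
  exists i, [/\ (i < k)%N, f i != f i.+1, forall j, (j <= i)%N -> f j = f 0%N
            & forall j, (i < j <= k)%N -> f j = f k].
Proof.
elim: k => [|k IHk]; first by rewrite /changes big_ord0.
rewrite /changes big_ord_recr /= -/(changes f k).
case: (eqVneq (f k) (f k.+1)) => [eq_fk|neq_fk] /=.
  rewrite addn0 => /IHk[i [lt_ik neq_fi before after]]; exists i; split=> //.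
    exact: ltnW.
  move=> j /andP[lt_ij]; rewrite leq_eqVlt => /predU1P[->//|lt_jk].
  by rewrite -eq_fk; apply: after; rewrite lt_ij.
rewrite addn1 => -[/changes_eq0 eq_f]; exists k; split=> // j lt_kj.
by congr f; lia.
Qed.

(* If every downward triangle of the hexagon changed its tile only once, the
   first flip would create a rhombus containing an upward triangle that is
   still covered by the initial rhombus of the next sector. *)
Lemma hexagon_changes (G : nat -> {fset tile}) (k : nat) (D : pred triangle)
    (v : point) :
  (forall i, (i <= k)%N -> partitions (G i) D) ->
  (forall i, (i < k)%N -> trapezoid_flip (G i) (G i.+1)) ->
  (forall o, tiles_at (G 0%N) (sector_down v o) = [fset cw_rhombus v o]) ->
  (forall o, tiles_at (G k) (sector_down v o) = [fset ccw_rhombus v o]) ->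
  exists o, (2 <= changes (fun i => tiles_at (G i) (sector_down v o)) k)%N.
Proof.
move=> partG flipG init final; apply/existsP; apply: contraT.
rewrite negb_exists => /forallP le1.
have eq1 o : changes (fun i => tiles_at (G i) (sector_down v o)) k = 1%N.
  move: (le1 o) (@changes_eq0 _ (fun i => tiles_at (G i) (sector_down v o)) k).
  case: (changes _ _) => [|[|//]] // _.
  move=> /(_ erefl k (leqnn k)); rewrite init final => /fset1_inj eq_r.
  by have := cw_neq_ccw_rhombus v o; rewrite eq_r eqxx.
have [t tP] := fin_all_exists (fun o => changes_eq1 (eq1 o)).
(* [t o] is the time of the only change in sector [o]. It strictly decreases from each sector to the
   next, which is absurd around a cycle of three. *)
have desc (o : 'I_3) : (t (o + 1)%R < t o)%N.
  have [lt_tk neq_t _ after] := tP o; have [_ neq_t' before _] := tP (o + 1).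
  rewrite ltn_neqAle; apply/andP; split.
    (* Simultaneous changes are impossible: one flip affects one downward triangle. *)
    apply/eqP => eq_t; rewrite eq_t in neq_t'.
    case: (trapezoid_flip_down (flipG _ lt_tk)
             (_ : (sector_down v o).2 != (sector_down v (o + 1)).2)).
    - exact: sector_down_next.
    - exact/eqP.
    - exact/eqP.
  (* If sector [o] changed first, its new rhombus and the old one of sector [o + 1] would both cover
     [sector_up v (o + 1)]. *)
  rewrite leqNgt; apply/negP => lt_t.
  have := after (t o).+1; rewrite ltnSn lt_tk final => /(_ isT) eq_o.
  have := before _ lt_t; rewrite init => eq_o1.
  have ccwG : ccw_rhombus v o \in G (t o).+1.
    have: ccw_rhombus v o \in tiles_at (G (t o).+1) (sector_down v o).
      by rewrite eq_o fset11.
    by rewrite !inE => /andP[->].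
  have cwG : cw_rhombus v (o + 1) \in G (t o).+1.
    have: cw_rhombus v (o + 1) \in
        tiles_at (G (t o).+1) (sector_down v (o + 1)).
      by rewrite eq_o1 fset11.
    by rewrite !inE => /andP[->].
  have := partitions_inj (partG _ lt_tk) ccwG cwG (fset22 _ _) (fset22 _ _).
  move/fsetP/(_ (sector_down v o)); rewrite fset21 => /esym/fset2P[|//].
  exact/eqP/sector_down_next.
have := ltn_trans (desc (0 + 1 + 1)) (ltn_trans (desc (0 + 1)) (desc 0)).
by rewrite (_ : 0 + 1 + 1 + 1 = 0 :> 'I_3) ?ltnn //; apply: val_inj.
Qed.

(** * Triangular arrays of indices and the density of hexagon centres *)

(** Listing the pairs by antidiagonals lets inductions peel off one diagonal at a time. *)
Fixpoint staircase (m : nat) : seq (nat * nat) :=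
  if m is m'.+1 then staircase m' ++ [seq (a, (m' - a)%N) | a <- iota 0 m]
  else [::].

Lemma mem_staircase (m : nat) (x : nat * nat) :
  (x \in staircase m) = (x.1 + x.2 < m)%N.
Proof.
case: x => a b; elim: m => [|m IHm] //=.
rewrite mem_cat IHm /= -[(0, _) :: _]/[seq (a, (m - a)%N) | a <- iota 0 m.+1].
apply/orP/idP => [[|/mapP[a']]|lt_ab].
- by lia.
- by rewrite mem_iota => ? [-> ->]; lia.
- have [?|?] := ltnP (a + b) m; [by left|right].
  by apply/mapP; exists a; rewrite ?mem_iota; [lia | congr (_, _); lia].
Qed.

Lemma staircase_uniq (m : nat) : uniq (staircase m).
Proof.
elim: m => // m IHm; rewrite [staircase m.+1]/(_ ++ _) cat_uniq IHm.
apply/andP; split=> //; apply/andP; split.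
  apply/hasPn => x /mapP[a]; rewrite mem_iota => ? ->.
  by rewrite mem_staircase /=; lia.
by rewrite map_inj_uniq ?iota_uniq // => ? ? [].
Qed.

Lemma size_staircase (m : nat) : (size (staircase m) * 2 = m * m.+1)%N.
Proof.
elim: m => // m IHm; rewrite [staircase m.+1]/(_ ++ _) size_cat size_map size_iota.
by rewrite mulnDl IHm; lia.
Qed.

Lemma count_staircaseS (P : pred (nat * nat)) (m : nat) :
  count P (staircase m.+1) =
    (count P (staircase m) + \sum_(a < m.+1) P (a : nat, (m - a)%N))%N.
Proof.
rewrite [staircase m.+1]/(_ ++ _) count_cat count_map -[X in (_ + X)%N]sum1_count big_mkcond.
congr addn; rewrite -(big_mkord xpredT (fun a => P (a, (m - a)%N) : nat)).
by rewrite /index_iota subn0; apply: eq_bigr => a _ /=; case: (P _).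
Qed.

(* Three consecutive diagonals consist of vertical triples and of one upward
   triangle. *)
Lemma count_staircase_ge (P : pred (nat * nat)) (m : nat) :
  (forall a b, [|| P (a, b), P (a, b.+1) | P (a, b.+2)]) ->
  (forall a b, [|| P (a, b), P (a.+1, b) | P (a, b.+1)]) ->
  (m * m.+1 <= 6 * count P (staircase m) + 6)%N.
Proof.
(* Sizes 0, 1 and 2 are paid for by the summand 6. From m to m + 3 the left side grows by 6(m + 2),
   matching m + 1 columns and one corner triangle. *)
move=> column corner; elim/ltn_ind: m => -[|[|[|m]]] IHm; try by lia.
have := IHm m; rewrite !count_staircaseS.
have ->: (\sum_(a < m.+2) P (a : nat, (m.+1 - a)%N) =
    \sum_(a < m.+1) P (a : nat, (m.+1 - a)%N) + P (m.+1, 0%N))%N.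
  by rewrite big_ord_recr /= subnn.
have ->: (\sum_(a < m.+3) P (a : nat, (m.+2 - a)%N) =
    \sum_(a < m.+1) P (a : nat, (m.+2 - a)%N) + P (m.+1, 1%N) + P (m.+2, 0%N))%N.
  by rewrite !big_ord_recr /= subnn subSnn.
have: (\sum_(a < m.+1) 1 <= \sum_(a < m.+1) P (a : nat, (m - a)%N) +
  \sum_(a < m.+1) P (a : nat, (m.+1 - a)%N) +
  \sum_(a < m.+1) P (a : nat, (m.+2 - a)%N))%N.
  rewrite -!big_split; apply: leq_sum => -[a lt_a] _ /=.
  have /= := column a (m - a)%N.
  have ->: (m.+1 - a = (m - a).+1)%N by lia.
  have ->: (m.+2 - a = (m - a).+2)%N by lia.
  by lia.
rewrite sum1_card card_ord.
(* The entries left over by the columns are (m + 1, 0), (m + 1, 1) and (m + 2, 0). *)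
have := corner m.+1 0%N.
by lia.
Qed.

Lemma count_le1 (T : eqType) (s : seq T) (P : pred T) :
  uniq s -> {in s &, forall x y, P x -> P y -> x = y} -> (count P s <= 1)%N.
Proof.
move=> uniq_s inj; rewrite -size_filter.
case def_f: (filter P s) => [|x [|y f]] //.
have /andP[Px xs]: P x && (x \in s) by rewrite -mem_filter def_f mem_head.
have /andP[Py ys]: P y && (y \in s) by rewrite -mem_filter def_f !inE eqxx orbT.
by have := filter_uniq P uniq_s; rewrite def_f (inj x y) //= mem_head.
Qed.

Section HexagonGrid.

Variables (c : pred point) (grid : hexagon_grid c).

Lemma hexagon_grid_inj (t : triangle) (v w : point) :
  c v -> c w -> v \in vertices t -> w \in vertices t -> v = w.
Proof.
move=> cv cw vt wt; have [u [_ uniq_u]] := grid t.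
by rewrite -(uniq_u v) // -(uniq_u w).
Qed.

Lemma hexagon_grid_up (a b : int) : [|| c (a, b), c (a + 1, b) | c (a, b + 1)].
Proof.
have [v [[cv /vertices_upP v_ab] _]] := grid (true, (a, b)).
by case: v_ab cv => -> ->; rewrite ?orbT.
Qed.

(** Otherwise the upward triangles at (a, b) and (a, b + 1) would have centres (a + 1, b) and (a +
    1, b + 1), two vertices of one downward triangle. *)
Lemma hexagon_grid_column (a b : int) :
  [|| c (a, b), c (a, b + 1) | c (a, b + 1 + 1)].
Proof.
have /or3P[-> //|c1|->] := hexagon_grid_up a b; rewrite ?orbT //.
have /or3P[->|c2|->] := hexagon_grid_up a (b + 1); rewrite ?orbT //.
have : (a + 1, b) = (a + 1, b + 1) :> point.
  by apply: (@hexagon_grid_inj (false, (a, b))) => //; apply/vertices_downP; constructor.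
by case; lia.
Qed.

End HexagonGrid.

(** Exchanging the sums, each flip contributes at most one change. *)
Lemma sum_changes_le (G : nat -> {fset tile}) (k : nat) (s : seq point) :
  uniq s -> (forall i, (i < k)%N -> trapezoid_flip (G i) (G i.+1)) ->
  (\sum_(x <- s) changes (fun i => tiles_at (G i) (false, x)) k <= k)%N.
Proof.
move=> uniq_s flipG; rewrite exchange_big /=.
rewrite -[leqRHS]muln1 -[k in leqRHS]card_ord -sum_nat_const.
apply: leq_sum => i _; rewrite -big_mkcond sum1_count /=.
apply: count_le1 => // x y _ _ neq_x neq_y; apply/eqP.
apply: contraNT neq_x => /(trapezoid_flip_down (flipG i (ltn_ord i)))[->//|eq_y].
by rewrite eq_y eqxx in neq_y.
Qed.

(** * The lower bound on the number of flips *)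

Section FlipCount.

Variables (n : nat) (p : point) (c : pred point) (k : nat).
Variable G : nat -> {fset tile}.
Hypothesis grid : hexagon_grid c.
Hypothesis initG : trimmed_tiling clockwise c p n (G 0%N).
Hypothesis finalG : trimmed_tiling counterclockwise c p n (G k).
Hypothesis partG : forall i, (i <= k)%N -> partitions (G i) (in_Delta p n).
Hypothesis flipG : forall i, (i < k)%N -> trapezoid_flip (G i) (G i.+1).

Let shift (x : nat * nat) : point := (p.1 + x.1%:Z, p.2 + x.2%:Z).
Let N (x : nat * nat) : nat :=
  changes (fun i => tiles_at (G i) (false, shift x)) k.

Let shift_inj : injective shift.
Proof. by move=> [a b] [a' b'] [? ?]; congr (_, _); lia. Qed.

Let in_Delta_shift x :
  x \in staircase n.-1 -> in_Delta p n (false, shift x).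
Proof. by rewrite mem_staircase in_Delta_down; lia. Qed.

Let initial_rhombus v o : c v -> in_Delta p n (sector_down v o) ->
  tiles_at (G 0%N) (sector_down v o) = [fset cw_rhombus v o].
Proof.
move=> cv dD; apply: (trimmed_tiles_at _ _ grid initG) => //.
- by move=> w P [].
- by move=> w P; apply: clockwise_cw_rhombus.
- exact: partG.
- exact: fset21.
- exact: (rhombus_in_Delta dD).1.
Qed.

Let final_rhombus v o : c v -> in_Delta p n (sector_down v o) ->
  tiles_at (G k) (sector_down v o) = [fset ccw_rhombus v o].
Proof.
move=> cv dD; apply: (trimmed_tiles_at _ _ grid finalG) => //.
- by move=> w P [].
- by move=> w P; apply: counterclockwise_ccw_rhombus.
- exact: partG.
- exact: fset21.
- exact: (rhombus_in_Delta dD).2.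
Qed.

Let changes_gt0 x : x \in staircase n.-1 -> (0 < N x)%N.
Proof.
move=> /in_Delta_shift xD; rewrite lt0n; apply/eqP => N0.
have := changes_eq0 N0 (leqnn k).
have [v [[cv vx] _]] := grid (false, shift x).
have [o def_x] := in_hexagon_down vx; rewrite def_x in xD *.
rewrite initial_rhombus // final_rhombus // => /fset1_inj/esym/eqP.
exact/negP/cw_neq_ccw_rhombus.
Qed.

(** A hexagon is indexed by its lower left downward triangle, [sector_down v 1], hence the offset by
    one. For [x] in [staircase n.-2] its three downward triangles lie in Delta. *)
Let centre (x : nat * nat) : bool := c (shift (x.1.+1, x.2.+1)).

(** Chooses a downward triangle of the hexagon that changes twice; the last branch is a default,
    justified by [hexagon_changes]. *)
Let twice_changed (x : nat * nat) : nat * nat :=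
  if (2 <= N (x.1, x.2.+1))%N then (x.1, x.2.+1)
  else if (2 <= N x)%N then x else (x.1.+1, x.2).

Let twice_changedP x : x \in staircase n.-2 -> centre x ->
  (2 <= N (twice_changed x))%N.
Proof.
case: x => a b; rewrite mem_staircase /= => lt_ab cx.
pose v := shift (a.+1, b.+1).
have sectorE : [/\ sector_down v 0 = (false, shift (a, b.+1)),
    sector_down v 1 = (false, shift (a, b))
    & sector_down v (1 + 1) = (false, shift (a.+1, b))].
  by split; congr (_, (_, _)) => /=; lia.
have inD o : in_Delta p n (sector_down v o).
  have [e0 e1 e2] := sectorE.
  by case: (ord3P o) => ->; rewrite ?e0 ?e1 ?e2; apply: in_Delta_shift;
    rewrite mem_staircase /=; lia.
have [o] := hexagon_changes partG flipG
  (fun o => initial_rhombus cx (inD o)) (fun o => final_rhombus cx (inD o)).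
have [e0 e1 e2] := sectorE; rewrite /twice_changed /=.
case: ifP => // n0; case: ifP => // n1.
case: (ord3P o) => ->; rewrite -/v ?e0 ?e1 ?e2 //.
  by rewrite -/(N (a, b.+1)) n0.
by rewrite -/(N (a, b)) n1.
Qed.

Let centre_twice_changed x :
  shift (x.1.+1, x.2.+1) \in vertices (false, shift (twice_changed x)).
Proof.
apply/vertices_downP; rewrite /twice_changed; case: ifP => _; last case: ifP => _.
- by constructor 1; congr (_, _) => /=; lia.
- by constructor 3; congr (_, _) => /=; lia.
- by constructor 2; congr (_, _) => /=; lia.
Qed.

Let mem_twice_changed x :
  x \in staircase n.-2 -> twice_changed x \in staircase n.-1.
Proof.
by rewrite !mem_staircase /twice_changed; case: ifP => _; last case: ifP => _;
  move=> /=; lia.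
Qed.

(** [twice_changed] is injective on centres, since a downward triangle lies in only one hexagon. *)
Let count_centre_le :
  (count centre (staircase n.-2) <= count (fun x => 2 <= N x) (staircase n.-1))%N.
Proof.
rewrite -!size_filter -(size_map twice_changed); apply: uniq_leq_size.
  rewrite map_inj_in_uniq ?filter_uniq ?staircase_uniq // => x y.
  rewrite !mem_filter => /andP[cx _] /andP[cy _] eq_xy.
  have /shift_inj[] : shift (x.1.+1, x.2.+1) = shift (y.1.+1, y.2.+1).
    apply: (hexagon_grid_inj grid cx cy (centre_twice_changed x)).
    by rewrite eq_xy; apply: centre_twice_changed.
  by case: x y {cx cy eq_xy} => ? ? [? ?] /= -> ->.
move=> _ /mapP[x + ->]; rewrite !mem_filter => /andP[cx xs].
by rewrite twice_changedP // mem_twice_changed.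
Qed.

(** There are n(n-1)/2 downward triangles and at least ((n-1)(n-2) - 6)/6 full hexagons, so 6k is at
    least 3n(n-1) + (n-1)(n-2) - 6 = 4n^2 - 6n - 4. *)
Lemma flip_count_ge : (1 <= n)%N -> (4 * n ^ 2 <= 6 * k + 6 * n + 6)%N.
Proof.
move=> n_gt0.
have le_k : (size (staircase n.-1) + count (fun x => 2 <= N x) (staircase n.-1)
    <= k)%N.
  have uniq_s : uniq (map shift (staircase n.-1)).
    by rewrite map_inj_uniq ?staircase_uniq.
  apply: leq_trans (sum_changes_le uniq_s flipG); rewrite big_map.
  rewrite -sum1_size -sum1_count [X in (_ + X)%N]big_mkcond -big_split /= big_seq [leqRHS]big_seq.
  (* A positive count is at least 1, plus 1 more if it reaches 2. *)
  apply: leq_sum => x /changes_gt0; rewrite -/(N x).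
  by case: (N x) => [|[|]].
have := @count_staircase_ge centre n.-2.
have column a b : [|| centre (a, b), centre (a, b.+1) | centre (a, b.+2)].
  have := hexagon_grid_column grid (p.1 + a.+1%:Z) (p.2 + b.+1%:Z).
  have <- : p.2 + b.+2%:Z = p.2 + b.+1%:Z + 1 by lia.
  by have <- : p.2 + b.+3%:Z = p.2 + b.+2%:Z + 1 by lia.
have corner a b : [|| centre (a, b), centre (a.+1, b) | centre (a, b.+1)].
  have := hexagon_grid_up grid (p.1 + a.+1%:Z) (p.2 + b.+1%:Z).
  have <- : p.1 + a.+2%:Z = p.1 + a.+1%:Z + 1 by lia.
  by have <- : p.2 + b.+2%:Z = p.2 + b.+1%:Z + 1 by lia.
move=> /(_ column corner); have := size_staircase n.-1.
(* The case n = 1 is separate because [n.-2] truncates there. *)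
move: count_centre_le le_k n_gt0; case: (n) => [//|[|m]] /=; first by lia.
by rewrite -[(_ ^ 2)%N]/(_ * _)%N; nia.
Qed.

End FlipCount.

Theorem mainTheorem5 :
  exists C : rat,
  forall (n : nat) (p : point) (c : pred point) (F1 F2 : {fset tile}),
    (1 <= n)%N ->
    hexagon_grid c ->
    trimmed_tiling clockwise c p n F1 ->
    trimmed_tiling counterclockwise c p n F2 ->
    forall k : nat, flips p n k F1 F2 ->
      2%:R * n%:R ^+ 2 / 3%:R - n%:R - C <= k%:R :> rat.
Proof.
(* The constant 1 is the final summand 6 of [flip_count_ge] divided by 6. *)
exists 1 => n p c F1 F2 n_gt0 grid tF1 tF2 k [G [eq_F1 eq_F2 fmsG flipG]].
rewrite -eq_F1 -eq_F2 in tF1 tF2.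
have partG i : (i <= k)%N -> partitions (G i) (in_Delta p n).
  by case/fmsG.
have := flip_count_ge grid tF1 tF2 partG flipG n_gt0.
rewrite -(ler_nat rat) !natrD !natrM.
by move: (n%:R) (k%:R) => x y; lra.
Qed.
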